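(* Let $S^-=\bigcup_{i=1}^{n-1}O_i$ and $S^o=\bigcup_{i=1}^{\lceil n/2\rceil}O_{2i-1}$ be two subsets of $Z_2^n$. The orbit Cayley graph $Cay(Z_2^n,S)$ is a trivial strongly regular Cayley graph if and only if $S\in\{S^-,S^o\}$. Furthermore, $Cay(Z_2^n,S^-)$ is $(2^n,\,2^n-2,\,2^n-4,\,2^n-2)$-strongly regular and $Cay(Z_2^n,S^o)$ is $(2^n,\,2^{n-1},\,0,\,2^{n-1})$-strongly regular.
   Context: $Z_2^n$ is the elementary abelian $2$-group, viewed as the vector space of dimension $n$ over the field $F_2$. For $v\in Z_2^n$, $|v|$ is the number of coordinates of $v$ equal to $1$, and $O_i=\{v\in Z_2^n : |v|=i\}$ for $0\le i\le n$. For a group $G$ and a subset $S$ of $G$, the Cayley graph $Cay(G,S)$ has vertex set $G$, with two vertices $x$ and $y$ adjacent if $x^{-1}y\in S$; if $S$ does not contain the identity and $S^{-1}=S$, it is an undirected simple graph. A Cayley graph $Cay(Z_2^n,S)$ is called an orbit Cayley graph if $S$ is the union of some of the $O_i$. A connected $r$-regular graph on $N$ vertices is strongly regular with parameters $(N,r,\lambda,\mu)$ (also called $(N,r,\lambda,\mu)$-strongly regular) if two vertices $x$ and $y$ have $\lambda$ common neighbours whenever they are adjacent and $\mu$ common neighbours whenever they are not adjacent. A strongly regular graph is trivial if its complement is disconnected.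
   Formalization: Complete graphs are not counted as strongly regular (otherwise S = O_1 ∪ … ∪ O_n would be a further trivial strongly regular case), and n ≥ 2 is assumed (for n ≤ 1 the set S^- is empty and the stated parameters are negative). *)

(* Defs.v *)
(* MathComp world. *)
From HB Require Import structures.
From mathcomp Require Import all_boot all_order all_fingroup all_algebra.

Set Implicit Arguments.
Unset Strict Implicit.
Unset Printing Implicit Defensive.

Import GroupScope.

Definition Cay (gT : finGroupType) (S : {set gT}) : rel gT :=
  [rel x y | x^-1 * y \in S].

Section Graphs.

Variables (T : finType) (e : rel T).

Definition simple_graph : Prop := symmetric e /\ irreflexive e.

Definition connected_graph : Prop := forall x y, connect e x y.

Definition complete_graph : Prop := forall x y, x != y -> e x y.

Definition regular (r : nat) : Prop := forall x, #|[set y | e x y]| = r.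

Definition common_nbrs (x y : T) : {set T} := [set z | e x z && e y z].

Definition complement : rel T := [rel x y | (x != y) && ~~ e x y].

(* As usual, complete graphs are not regarded as strongly regular: for them
   the condition on mu is vacuous. *)
Definition strongly_regular (N r lambda mu : nat) : Prop :=
  [/\ simple_graph /\ ~ complete_graph,
      connected_graph,
      #|T| = N /\ regular r,
      forall x y, e x y -> #|common_nbrs x y| = lambda
    & forall x y, x != y -> ~~ e x y -> #|common_nbrs x y| = mu].

End Graphs.

Definition trivial_strongly_regular (T : finType) (e : rel T) : Prop :=
  (exists N r lambda mu, strongly_regular e N r lambda mu) /\
  ~ connected_graph (complement e).

Section Orbits.

Variable n : nat.

(* Z_2^n; its finGroupType structure is the additive group, so that in Cay
   the product x^-1 * y is - x + y and the identity is 0. *)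
Definition Z2n : finGroupType := 'rV['F_2]_n.

Definition weight (v : 'rV['F_2]_n) : nat := #|[set i | v ord0 i == 1%R]|.

Definition O (i : nat) : {set Z2n} := [set v | weight v == i].

Definition orbit_union (S : {set Z2n}) : Prop :=
  exists I : {set 'I_n.+1}, S = \bigcup_(i in I) O i.

Definition Sminus : {set Z2n} := \bigcup_(1 <= i < n) O i.

(* uphalf n is the ceiling of n/2. *)
Definition Sodd : {set Z2n} := \bigcup_(1 <= i < (uphalf n).+1) O (2 * i - 1).

End Orbits.

(* Main.v *)
Require Import Defs.
From HB Require Import structures.
From mathcomp Require Import all_boot all_order all_fingroup all_algebra.

(** A strongly regular graph whose complement is disconnected is complete
    multipartite. Indeed the number of vertices non-adjacent to both ends of an
    edge xy depends only on the parameters; it is 0 when x and y lie in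
    different components of the complement, hence it is always 0, which says
    exactly that non-adjacency is transitive ([nonadj_trans]).

    For a Cayley graph this means that the complement of the connection set is
    a subgroup H, the parts being the left cosets of H; conversely every
    proper nontrivial subgroup gives such a graph, whose parameters are read
    off from the sizes of cosets ([trivial_srg_CayP], [srg_Cay_setC]).

    It remains to find the subgroups H of Z_2^n that are unions of weight
    classes ([weight_closed_group]). If H contains a vector v of weight
    neither 0 nor n, moving one of the ones of v to a zero coordinate gives
    another vector of H, and the sum of the two is e_i + e_j. Then H contains
    all vectors e_i + e_j, which generate the vectors of even weight, a subgroup
    of index 2. Otherwise H only contains 0 and the all-one vector. The
    complements of these two subgroups are the sets of the statement. *)

Set Implicit Arguments.
Unset Strict Implicit.
Unset Printing Implicit Defensive.

Import GRing.Theory.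

(** * Trivial strongly regular graphs *)

Section Graphs.

Variables (T : finType) (e : rel T).

(** By regularity and inclusion-exclusion, an edge xy leaves
    N - (2 * r - lambda) vertices outside the neighbourhoods of x and y, the
    same number for all edges; an edge joining two components of the
    complement leaves none. *)
Lemma nonadj_trans N r lambda mu :
    strongly_regular e N r lambda mu -> ~ connected_graph (complement e) ->
  forall x y z, ~~ e x y -> ~~ e y z -> ~~ e x z.
Proof.
move=> [[[esym eirr] _] _ [_ reg] lamP _] disc.
pose nb x := [set y | e x y].
have cardU x y : e x y -> #|nb x :|: nb y| = r + r - lambda.
  move=> exy; rewrite cardsU !reg -(lamP x y exy).
  by congr (_ - #|pred_of_set _|); apply/setP=> z; rewrite !inE.
have [/forallP allc | ] := boolP [forall x, forall y, connect (complement e) x y].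
  by case: disc => x y; move/forallP: (allc x).
rewrite negb_forall => /existsP[a]; rewrite negb_forall => /existsP[b nab].
have neq_ab : a != b by apply: contraNneq nab => ->; rewrite connect0.
have eab : e a b.
  by apply: contraNT nab => neab; apply: connect1; rewrite /complement /= neq_ab.
have Uab : nb a :|: nb b = setT.
  apply/setP=> z; rewrite !inE; apply: contraNT nab.
  rewrite negb_or => /andP[naz nbz].
  have step u v : ~~ e u v -> connect (complement e) u v.
    by have [-> // | neq] := eqVneq u v => nuv; apply: connect1; rewrite /complement /= neq.
  by apply: connect_trans (step a z naz) (step z b _); rewrite esym.
move=> x y z nxy nyz; apply/negP=> exz.
have : nb x :|: nb z = setT.
  by apply/eqP; rewrite eqEcard subsetT (cardU x z exz) -(cardU a b eab) Uab leqnn.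
by move/setP/(_ y); rewrite !inE (negbTE nxy) esym (negbTE nyz).
Qed.

End Graphs.

Section CayleyGraphs.

Local Open Scope group_scope.

Variable gT : finGroupType.
Implicit Types (S : {set gT}) (H : {group gT}).

Lemma CayE S x y : Cay S x y = (x^-1 * y \in S). Proof. by []. Qed.

Lemma Cay_setC H x y : Cay (~: H) x y = (y \notin x *: H).
Proof. by rewrite CayE inE mem_lcoset. Qed.

Lemma nbrs_Cay_setC H x : [set y | Cay (~: H) x y] = ~: (x *: H).
Proof. by apply/setP=> y; rewrite in_setC -Cay_setC inE. Qed.

Lemma common_nbrs_Cay_setC H x y :
  common_nbrs (Cay (~: H)) x y = ~: (x *: H :|: y *: H).
Proof.
by apply/setP=> z; rewrite in_setC in_setU negb_or -!Cay_setC inE.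
Qed.

Lemma notin_Cay_setC H x y : ~~ Cay (~: H) x y -> x *: H = y *: H.
Proof. by rewrite Cay_setC negbK => /lcoset_eqP. Qed.

(** The graph is complete multipartite, with the left cosets of H as parts. *)
Lemma srg_Cay_setC H : H :!=: 1 -> H :!=: setT ->
  strongly_regular (Cay (~: H)) #|gT| (#|gT| - #|H|)
    (#|gT| - (#|H| + #|H|)) (#|gT| - #|H|).
Proof.
move=> ntH prH.
have csym : symmetric (Cay (~: H)).
  by move=> x y; rewrite !CayE !inE -groupV invMg invgK.
split.
- split; first by split=> // x; rewrite CayE mulVg inE group1.
  move=> complete; have /trivgPn[h Hh nth] := ntH.
  have := complete 1 h; rewrite eq_sym => /(_ nth).
  by rewrite !CayE invg1 mul1g inE Hh.
- move=> x y; have [/connect1 // | /notin_Cay_setC xy] := boolP (Cay (~: H) x y).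
  (* two vertices of the same part have a common neighbour in any other part *)
  have [g nHg] : exists g, g \notin H.
    by apply/existsP; rewrite -negb_forall; apply: contraNN prH => /forallP GH;
      apply/eqP/setP=> g; rewrite GH inE.
  have exg : Cay (~: H) x (x * g) by rewrite Cay_setC mem_lcoset mulKg.
  apply: connect_trans (connect1 exg) (connect1 _).
  by rewrite csym Cay_setC -xy -Cay_setC.
- by split=> // x; rewrite nbrs_Cay_setC cardsCs setCK card_lcoset.
- move=> x y exy; rewrite common_nbrs_Cay_setC cardsCs setCK cardsU.
  rewrite !card_lcoset; suff -> : x *: H :&: y *: H = set0 by rewrite cards0 subn0.
  apply/setP=> z; rewrite in_set0 in_setI; apply/negP=> /andP[xz yz].
  move: exy; rewrite Cay_setC; case/negP.
  by rewrite -(lcoset_eqP xz) (lcoset_eqP yz) lcoset_refl.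
- move=> x y _ /notin_Cay_setC xy.
  by rewrite common_nbrs_Cay_setC xy setUid cardsCs setCK card_lcoset.
Qed.

(** Paths of the complement stay inside a left coset of H. *)
Lemma disconnected_compl_Cay_setC H :
  H :!=: setT -> ~ connected_graph (complement (Cay (~: H))).
Proof.
move=> prH conn; case/eqP: prH; apply/setP=> g; rewrite inE.
have /connectP[p] := conn 1 g.
suff {g} main : forall x y, path (complement (Cay (~: H))) x p ->
    y = last x p -> x *: H = y *: H.
  move=> pp gE; have := lcoset_refl H g.
  by rewrite -(main 1 g pp gE) mem_lcoset invg1 mul1g.
elim: p => [|z p IHp] x y /=; first by move=> _ ->.
by case/andP=> /andP[_ /notin_Cay_setC ->]; apply: IHp.
Qed.

Lemma trivial_srg_CayP S :
  trivial_strongly_regular (Cay S) <->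
  exists H : {group gT}, [/\ H :!=: 1, H :!=: setT & S = ~: H].
Proof.
split=> [|[H [ntH prH ->]]]; last first.
  split; last exact: disconnected_compl_Cay_setC.
  by do 4!eexists; apply: srg_Cay_setC.
move=> [[N [r [lambda [mu srg]]]] disc].
have ntrans := nonadj_trans srg disc.
case: srg => [[[_ eirr] ncomplete] conn _ _ _].
have notS1 : 1 \notin S by have := eirr 1; rewrite !CayE invg1 mul1g => ->.
have gH : group_set (~: S).
  apply/group_setP; split=> [|x y]; first by rewrite inE.
  rewrite !inE => Sx Sy; have := ntrans 1 x (x * y).
  by rewrite !CayE invg1 !mul1g mulKg; apply.
exists (Group gH); split; last by rewrite /= setCK.
- apply/eqP=> H1; apply: ncomplete => x y neq; rewrite CayE.
  have /setP/(_ (x^-1 * y)) := H1; rewrite !inE -eq_mulVg1 (negbTE neq).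
  by move/negbFE.
- apply/eqP=> HT.
  have S0 z : z \in S = false by have /setP/(_ z) := HT; rewrite !inE => /negbTE.
  apply: ncomplete => x y; case/connectP: (conn x y) => -[_ -> /eqP // | z p] /=.
  by rewrite CayE S0.
Qed.

End CayleyGraphs.

(** * Weights of binary vectors *)

Lemma F2_case (a : 'F_2) : a = (a == 1%R)%:R%R.
Proof. by case: a => [[|[|m]] lt_m]; apply/val_inj. Qed.

Section BinarySpace.

Variable n : nat.
Implicit Types (v w : 'rV['F_2]_n) (H : {group Z2n n}).

Definition supp v : {set 'I_n} := [set i | v ord0 i == 1%R].

Lemma weight_supp v : weight v = #|supp v|. Proof. by []. Qed.

Lemma supp_inj : injective supp.
Proof.
move=> v w /setP vw; apply/rowP=> i; rewrite [LHS]F2_case [RHS]F2_case.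
by have := vw i; rewrite !inE => ->.
Qed.

Lemma in_suppD v w i : (i \in supp (v + w)%R) = (i \in supp v) (+) (i \in supp w).
Proof.
rewrite !inE mxE [v ord0 i]F2_case [w ord0 i]F2_case.
by case: (v ord0 i == 1%R); case: (w ord0 i == 1%R).
Qed.

Lemma addvv v : (v + v = 0)%R.
Proof.
by apply: supp_inj; apply/setP=> i; rewrite in_suppD addbb inE mxE eq_sym oner_eq0.
Qed.

Lemma supp0 : supp 0%R = set0.
Proof. by apply/setP=> i; rewrite !inE mxE eq_sym oner_eq0. Qed.

Lemma supp1 : supp (const_mx 1%R) = setT.
Proof. by apply/setP=> i; rewrite !inE mxE eqxx. Qed.

Lemma weight_eq0 v : (weight v == 0) = (v == 0%R).
Proof. by rewrite weight_supp cards_eq0 -supp0 (inj_eq supp_inj). Qed.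

Lemma weight_eqn v : (weight v == n) = (v == const_mx 1%R).
Proof.
rewrite -(inj_eq supp_inj) supp1 eqEcard subsetT cardsT card_ord eqn_leq.
by rewrite -[X in _ <= X]card_ord max_card.
Qed.

Lemma weight_le v : weight v <= n.
Proof. by rewrite -[X in _ <= X]card_ord max_card. Qed.

Definition unitv (i : 'I_n) : 'rV['F_2]_n := delta_mx ord0 i.

Lemma supp_unitv i : supp (unitv i) = [set i].
Proof. by apply/setP=> j; rewrite !inE mxE /=; case: (j == i). Qed.

Lemma weight_unitvD i j : i != j -> weight (unitv i + unitv j)%R = 2.
Proof.
move=> neq; rewrite weight_supp -[RHS]/(true.+1) -neq -cards2.
congr #|pred_of_set _|; apply/setP=> k.
rewrite in_suppD !supp_unitv !inE.
by have [->|] := eqVneq k i; rewrite ?(negbTE neq).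
Qed.

(** Adding e_i + e_j moves a one of v from i to the zero coordinate j; this is
    how a weight class yields vectors of the form e_i + e_j. *)
Lemma weight_move v i j : i \in supp v -> j \notin supp v ->
  weight (v + (unitv i + unitv j))%R = weight v.
Proof.
move=> vi vj; have ji : j != i by apply: contraNneq vj => ->.
have -> : weight v = #|j |: (supp v :\ i)|.
  rewrite cardsU1 in_setD1 ji (negbTE vj) add1n weight_supp (cardsD1 i) vi add1n.
  by [].
rewrite weight_supp; congr #|pred_of_set _|; apply/setP=> k.
rewrite !in_suppD !supp_unitv !inE -/(supp v).
have [->|] := eqVneq k j; first by rewrite (negbTE ji); move: vj; rewrite inE => /negbTE->.
by have [-> _|] := eqVneq k i; [move: vi; rewrite inE => -> | rewrite !addbF].
Qed.

(** The parity of the weight is thus a linear form, which makes the even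
    weights a subgroup. *)
Lemma sum_coord v : (\sum_i v ord0 i = (odd (weight v))%:R :> 'F_2)%R.
Proof.
rewrite (eq_bigr (fun i => (v ord0 i == 1)%:R)%R) => [|i _]; last exact: F2_case.
rewrite -natr_sum -big_mkcond sum1_card -cardsE -/(weight v).
rewrite -[X in X%:R%R]odd_double_half natrD -muln2 natrM.
by rewrite (_ : 2%:R = 0 :> 'F_2)%R ?mulr0 ?addr0 //; apply/val_inj.
Qed.

Lemma odd_weightD v w :
  odd (weight (v + w)%R) = odd (weight v) (+) odd (weight w).
Proof.
have := sum_coord (v + w)%R; under eq_bigr => i _ do rewrite mxE.
rewrite big_split /= !sum_coord.
by case: (odd _); case: (odd _); case: (odd _).
Qed.

Lemma Z2nM (x y : Z2n n) : (x * y)%g = (x + y)%R. Proof. by []. Qed.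

(** * Subgroups that are unions of weight classes *)

Definition even_weight : {set Z2n n} := [set v | ~~ odd (weight v)].
Definition constants : {set Z2n n} := [set 0%R; const_mx 1%R].

Lemma even_weight_group_set : group_set even_weight.
Proof.
apply/group_setP; split=> [|v w]; rewrite !inE.
  by have /eqP -> : weight (0%R : 'rV['F_2]_n) == 0 by rewrite weight_eq0.
by rewrite Z2nM odd_weightD => /negbTE -> /negbTE ->.
Qed.
Canonical even_weight_group := Group even_weight_group_set.

Lemma constants_group_set : group_set constants.
Proof.
apply/group_setP; split=> [|v w]; first exact: set21.
rewrite Z2nM => /set2P[]-> /set2P[]->.
- by rewrite addr0 set21.
- by rewrite add0r set22.
- by rewrite addr0 set22.
- by rewrite addvv set21.
Qed.
Canonical constants_group := Group constants_group_set.

Lemma in_constants (v : Z2n n) : (v \in constants) = (weight v == 0) || (weight v == n).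
Proof. by rewrite weight_eq0 weight_eqn in_set2. Qed.

Definition weight_closed (A : {set Z2n n}) :=
  forall v w, weight v = weight w -> v \in A -> w \in A.

(** If v has even weight, then v is the sum of the v_i (e_i + e_k) for any
    fixed k, since the v_i add up to 0. *)
Lemma even_weight_sub H (k : 'I_n) :
  (forall i, (unitv i + unitv k)%R \in H) -> even_weight \subset H.
Proof.
move=> Hik; apply/subsetP=> v; rewrite inE => even_v.
have -> : v = (\sum_i v ord0 i *: (unitv i + unitv k))%R.
  under eq_bigr => i _ do rewrite scalerDr.
  by rewrite big_split /= -scaler_suml sum_coord (negbTE even_v) scale0r addr0
    -row_sum_delta.
apply: (big_ind (fun x : Z2n n => x \in H)) => [|x y Hx Hy|i _].
- exact: group1.
- exact: groupM.
- rewrite [v ord0 i]F2_case; case: eqP => _; last by rewrite scale0r; apply: group1.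
  by rewrite scale1r.
Qed.

(** Vectors of odd weight differ by vectors of even weight, so a subgroup
    containing the even ones contains all the odd ones or none. *)
Lemma odd_in_group H (v : Z2n n) :
  even_weight \subset H -> v \in H -> odd (weight v) -> H :=: setT.
Proof.
move=> /subsetP subH Hv odd_v; apply/setP=> w; rewrite inE.
have [odd_w | even_w] := boolP (odd (weight w)); last by apply: subH; rewrite inE.
have -> : w = (v * (v + w)%R)%g by rewrite Z2nM addrA addvv add0r.
by apply: groupM => //; apply: subH; rewrite inE odd_weightD odd_v odd_w.
Qed.

(** A vector v of H outside the two constant ones has both a one and a zero
    coordinate; with [weight_move] this puts some e_i + e_j in H, hence all of
    them, hence all even weights, and [odd_in_group] leaves no room for more. *)
Lemma weight_closed_group H : weight_closed H -> H :!=: 1%g -> H :!=: setT ->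
  H :=: constants \/ H :=: even_weight.
Proof.
move=> wH ntH prH.
have [subH | /subsetPn[v Hv v_nconst]] := boolP (H \subset constants); [left | right].
  apply/eqP; rewrite eqEsubset subH /=; have /trivgPn[v Hv nt_v] := ntH.
  have : v \in constants by apply: (subsetP subH).
  rewrite in_set2 -[v == 0%R]/(v == 1%g) (negbTE nt_v) /= => /eqP v1.
  by apply/subsetP=> w /set2P[] ->; rewrite ?group1 // -v1.
move: v_nconst; rewrite in_constants negb_or -lt0n.
case/andP=> [v_gt0 v_neqn].
have [i vi] : exists i, i \in supp v by apply/card_gt0P.
have [j vj] : exists j, j \notin supp v.
  apply/existsP; rewrite -negb_forall; apply: contraNN v_neqn => /forallP vT.
  by rewrite weight_eqn -(inj_eq supp_inj) supp1; apply/eqP/setP=> k; rewrite vT inE.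
have Hij : (unitv i + unitv j)%R \in H.
  have -> : (unitv i + unitv j = v + (v + (unitv i + unitv j)))%R.
    by rewrite addrA addvv add0r.
  by rewrite -Z2nM groupM // (wH v) // weight_move.
have ij : i != j by apply: contraNneq vj => <-.
have subH : even_weight \subset H.
  apply: (@even_weight_sub H j) => k.
  have [-> | neq] := eqVneq k j; first by rewrite addvv group1.
  by apply: wH Hij; rewrite !weight_unitvD.
apply/eqP; rewrite eqEsubset subH andbT; apply/subsetP=> w Hw; rewrite inE.
by apply: contraNN prH => odd_w; apply/eqP; apply: odd_in_group Hw odd_w.
Qed.

Lemma orbit_union_weight_closed (S : {set Z2n n}) :
  orbit_union S -> weight_closed (~: S).
Proof.
move=> [I ->] v w vw; rewrite !inE; apply: contraNN => /bigcupP[i Ii].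
by rewrite inE -vw => vi; apply/bigcupP; exists i; rewrite ?inE.
Qed.

(** * The two connection sets *)

Lemma in_bigcup_seq (r : seq nat) (F : nat -> {set Z2n n}) v :
  (v \in \bigcup_(i <- r) F i) = has (fun i => v \in F i) r.
Proof.
by elim: r => [|i r IHr]; rewrite ?big_nil ?inE // big_cons inE IHr.
Qed.

Lemma Sminus_setC : Sminus n = ~: constants.
Proof.
apply/setP=> v; rewrite inE in_constants in_bigcup_seq negb_or.
apply/hasP/andP=> [[i] | [v_gt0 v_neqn]].
  rewrite mem_index_iota inE => /andP[i_gt0 lt_in] /eqP ->.
  by rewrite -lt0n i_gt0 (ltn_eqF lt_in).
exists (weight v); rewrite ?inE // mem_index_iota lt0n v_gt0.
by rewrite ltn_neqAle v_neqn weight_le.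
Qed.

Lemma Sodd_setC : Sodd n = ~: even_weight.
Proof.
apply/setP=> v; rewrite !inE negbK in_bigcup_seq.
apply/hasP/idP=> [[i] | odd_v].
  rewrite mem_index_iota inE => /andP[i_gt0 _] /eqP ->.
  by rewrite oddB ?oddM // (leq_trans i_gt0) // leq_pmull.
(* 2 * uphalf w = w + 1 when w is odd *)
exists (uphalf (weight v)).
  rewrite mem_index_iota uphalf_gt0 odd_gt0 //= ltnS.
  exact/uphalf_leq/weight_le.
by rewrite inE mul2n -[X in X == _](addnK 1) addn1 -[in X in X - 1](odd_uphalfK odd_v).
Qed.

Lemma card_Z2n : #|Z2n n| = 2 ^ n.
Proof. by rewrite card_mx card_Fp // mul1n. Qed.

Hypothesis n_gt1 : 1 < n.

Let i0 : 'I_n := Ordinal (ltnW n_gt1).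
Let i1 : 'I_n := Ordinal n_gt1.

Lemma weight_unitv i : weight (unitv i) = 1.
Proof. by rewrite weight_supp supp_unitv cards1. Qed.

Lemma constants_neq1 : constants != 1%g.
Proof.
apply/trivgPn; exists (const_mx 1%R : Z2n n); first exact: set22.
rewrite -[_ == _]/(const_mx 1%R == 0%R :> 'rV['F_2]_n) -weight_eq0.
have /eqP -> : weight (const_mx 1%R : 'rV['F_2]_n) == n by rewrite weight_eqn.
by rewrite -lt0n ltnW.
Qed.

Lemma constants_neqT : constants != setT.
Proof.
apply/eqP=> /setP/(_ (unitv i0 : Z2n n)).
by rewrite in_constants weight_unitv inE /= (ltn_eqF n_gt1).
Qed.

Lemma even_weight_neq1 : even_weight != 1%g.
Proof.
have w2 : weight (unitv i0 + unitv i1)%R = 2 by apply: weight_unitvD.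
apply/trivgPn; exists (unitv i0 + unitv i1 : Z2n n)%R; first by rewrite inE w2.
rewrite -[_ == _]/(unitv i0 + unitv i1 == 0 :> 'rV['F_2]_n)%R -weight_eq0.
by rewrite w2.
Qed.

Lemma even_weight_neqT : even_weight != setT.
Proof.
by apply/eqP=> /setP/(_ (unitv i0 : Z2n n)); rewrite !inE weight_unitv.
Qed.

Lemma card_constants : #|constants| = 2.
Proof.
rewrite cards2; apply/eqP; rewrite eqSS eqb1 eq_sym.
have /trivgPn[v /set2P[] ->] := constants_neq1; last by [].
by rewrite eqxx.
Qed.

(** Translation by a vector of odd weight exchanges the two parity classes. *)
Lemma card_even_weight : #|even_weight| = 2 ^ n.-1.
Proof.
pose v : Z2n n := unitv i0.
have coset : (v *: even_weight)%g = ~: even_weight.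
  have vV : (v^-1 = v)%g by apply/eqP; rewrite eq_invg_mul Z2nM addvv.
  apply/setP=> w; rewrite mem_lcoset vV !inE Z2nM odd_weightD weight_unitv.
  by [].
apply/eqP; rewrite -(eqn_pmul2l (isT : 0 < 2)) -expnS prednK ?(ltnW n_gt1) //.
by rewrite -card_Z2n -(cardsC even_weight) -coset card_lcoset mul2n addnn.
Qed.

End BinarySpace.

Theorem theorem4 (n : nat) (hn : 2 <= n) :
  (forall S : {set Z2n n}, orbit_union S ->
     (trivial_strongly_regular (Cay S) <-> S = Sminus n \/ S = Sodd n)) /\
  strongly_regular (Cay (Sminus n))
    (2 ^ n) (2 ^ n - 2) (2 ^ n - 4) (2 ^ n - 2) /\
  strongly_regular (Cay (Sodd n))
    (2 ^ n) (2 ^ (n - 1)) 0 (2 ^ (n - 1)).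
Proof.
rewrite Sminus_setC Sodd_setC; split=> [S orbS|]; last split.
- split=> [/trivial_srg_CayP[H [ntH prH SE]] | SE]; last first.
    apply/trivial_srg_CayP; case: SE => ->.
    + exists (constants_group n).
      by split; [apply: constants_neq1 | apply: constants_neqT |].
    + exists (even_weight_group n).
      by split; [apply: even_weight_neq1 | apply: even_weight_neqT |].
  have := orbit_union_weight_closed orbS; rewrite SE setCK => wH.
  by case: (weight_closed_group wH ntH prH) => ->; [left | right].
- have := srg_Cay_setC (constants_neq1 hn) (constants_neqT hn).
  by rewrite /= card_constants // card_Z2n.
- have := srg_Cay_setC (even_weight_neq1 hn) (even_weight_neqT hn).
  rewrite /= card_even_weight // card_Z2n addnn -mul2n -expnS prednK ?(ltnW hn) //.
  rewrite subnn; have -> : 2 ^ n - 2 ^ n.-1 = 2 ^ (n - 1); last by [].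
  by rewrite -[in 2 ^ n](prednK (ltnW hn)) expnS mul2n -addnn addnK subn1.
Qed.
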